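(* Let $(t,m_1,\dots,m_N)\in[0,T]\times\Omega\mapsto(U_1(t,m_1,\dots,m_N),\dots,U_N(t,m_1,\dots,m_N))$ be a $C^1$ function satisfying the $\mathcal{G}$-Master equations. Let $m:t\in[0,T]\mapsto m(t)=(m(t,1),\dots,m(t,N))\in\Omega$ be a $C^1$ function satisfying, for all $i\in\mathcal{N}$, $$\frac{d}{dt}m(t,i)=\sum_{j\in\mathcal{V}^{-1}(i)}\frac{\partial H(j,\cdot)}{\partial p_i}\big((U_k(t,m(t))-U_j(t,m(t)))_{k\in\mathcal{V}(j)}\big)m(t,j)-\sum_{j\in\mathcal{V}(i)}\frac{\partial H(i,\cdot)}{\partial p_j}\big((U_k(t,m(t))-U_i(t,m(t)))_{k\in\mathcal{V}(i)}\big)m(t,i)$$ with $m(0)=m^0\in\mathcal{P}_N$. Define $u(t,i)=U_i(t,m(t))$ for all $i\in\mathcal{N}$. Then $t\in[0,T]\mapsto(u(t,1),\dots,u(t,N),m(t,1),\dots,m(t,N))$ is a solution of the $\mathcal{G}$-MFG equations with initial condition $m^0$.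
   Context: Setting. $\mathcal{G}$ is a directed graph with nodes $\mathcal{N}=\{1,\dots,N\}$; $\mathcal{V}(i)\subset\mathcal{N}\setminus\{i\}$ is the set of $j$ with a directed edge from $i$ to $j$, $d_i=|\mathcal{V}(i)|$, and $\mathcal{V}^{-1}(i)\subset\mathcal{N}\setminus\{i\}$ is the set of $j$ with a directed edge from $j$ to $i$. Vectors of $\mathbb{R}^{d_i}$ are indexed by $\mathcal{V}(i)$. $T>0$ is fixed. For each $i$, $L(i,\cdot):\mathbb{R}_+^{d_i}\to\mathbb{R}$ is continuous with $\lim_{|\lambda|\to+\infty}L(i,\lambda)/|\lambda|=+\infty$. The Hamiltonian is $H(i,p)=\sup_{\lambda\in\mathbb{R}_+^{d_i}}\big(\lambda\cdot p-L(i,\lambda)\big)$ for $p\in\mathbb{R}^{d_i}$; it is assumed that each $H(i,\cdot)$ is $C^1$ with $\nabla H(i,p)=\mathrm{argmax}_{\lambda\in\mathbb{R}_+^{d_i}}\big(\lambda\cdot p-L(i,\lambda)\big)$. $\frac{\partial H(i,\cdot)}{\partial p_j}$, $j\in\mathcal{V}(i)$, is the partial derivative in the coordinate indexed by $j$. $\mathcal{P}_N=\{x\in[0,1]^N:\sum_i x_i=1\}$; $\Omega\subset\mathbb{R}^N$ is a domain (open connected set) containing $\mathcal{P}_N$; $f,g:\mathcal{N}\times\Omega\to\mathbb{R}$ with $f(i,\cdot),g(i,\cdot)$ continuous on $\Omega$ for each $i$. $\mathcal{G}$-Master equations (unknown $U=(U_1,\dots,U_N):[0,T]\times\Omega\to\mathbb{R}^N$):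 for all $i\in\mathcal{N}$, with all $U$'s evaluated at $(t,m)=(t,m_1,\dots,m_N)$, $$\frac{\partial U_i}{\partial t}+H\big(i,(U_j-U_i)_{j\in\mathcal{V}(i)}\big)+\sum_{l=1}^N\frac{\partial U_i}{\partial m_l}\Big[\sum_{j\in\mathcal{V}^{-1}(l)}\frac{\partial H(j,\cdot)}{\partial p_l}\big((U_k-U_j)_{k\in\mathcal{V}(j)}\big)m_j-\sum_{j\in\mathcal{V}(l)}\frac{\partial H(l,\cdot)}{\partial p_j}\big((U_k-U_l)_{k\in\mathcal{V}(l)}\big)m_l\Big]+f(i,m)=0,$$ with $U_i(T,m)=g(i,m)$. $\mathcal{G}$-MFG equations (unknown $(u,m):[0,T]\to\mathbb{R}^N\times\Omega$, with $m^0\in\mathcal{P}_N$ given): for all $i\in\mathcal{N}$, $$\frac{d}{dt}u(t,i)+H\big(i,(u(t,j)-u(t,i))_{j\in\mathcal{V}(i)}\big)+f(i,m(t))=0,\qquad u(T,i)=g(i,m(T)),$$ $$\frac{d}{dt}m(t,i)=\sum_{j\in\mathcal{V}^{-1}(i)}\frac{\partial H(j,\cdot)}{\partial p_i}\big((u(t,k)-u(t,j))_{k\in\mathcal{V}(j)}\big)m(t,j)-\sum_{j\in\mathcal{V}(i)}\frac{\partial H(i,\cdot)}{\partial p_j}\big((u(t,k)-u(t,i))_{k\in\mathcal{V}(i)}\big)m(t,i),$$ with $m(0)=m^0$. *)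

(* Defs.v *)
From HB Require Import structures.
From mathcomp Require Import all_boot all_order all_algebra.
From mathcomp Require Import all_classical all_reals all_analysis.

Set Implicit Arguments.
Unset Strict Implicit.
Unset Printing Implicit Defensive.

Import Order.TTheory GRing.Theory Num.Theory.
Import numFieldNormedType.Exports.
Local Open Scope classical_set_scope.
Local Open Scope ring_scope.

Section Graph.
Variables (N : nat) (edge : rel 'I_N).

Definition succs (i : 'I_N) : {set 'I_N} := [set j | edge i j]%SET.

Definition preds (i : 'I_N) : {set 'I_N} := [set j | edge j i]%SET.

Definition deg (i : 'I_N) : nat := #|succs i|.

End Graph.

(* Vectors indexed by [succs edge i] are row vectors of length [deg edge i]:
   column [a] is the coordinate indexed by the node [enum_val a]. *)
Definition succ_node (N : nat) (edge : rel 'I_N) (i : 'I_N)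
  (a : 'I_(deg edge i)) : 'I_N := enum_val a.

Section Calculus.
Variable R : realType.

Definition orthant (n : nat) : set 'rV[R]_n := [set x | forall k, 0 <= x 0 k].

Definition dotv (n : nat) (x y : 'rV[R]_n) : R := \sum_(k < n) x 0 k * y 0 k.

Definition simplex (n : nat) : set 'rV[R]_n :=
  [set x | (forall k, 0 <= x 0 k <= 1) /\ \sum_(k < n) x 0 k = 1].

Definition partial_mx (n : nat) (h : 'rV[R]_n -> R) (k : 'I_n) (x : 'rV[R]_n)
  : R := 'D_(delta_mx 0 k) h x.

Definition gradient (n : nat) (h : 'rV[R]_n -> R) (x : 'rV[R]_n) : 'rV[R]_n :=
  \row_k partial_mx h k x.

Definition C1 (n : nat) (h : 'rV[R]_n -> R) : Prop :=
  forall k : 'I_n,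
    (forall x, derivable h x (delta_mx 0 k)) /\ continuous (partial_mx h k).

(* Derivative of a function on [0, T], one-sided at the endpoints: the
   increment ranges over points [s != t] of [0, T] only. *)
Definition diff_quot (h : R -> R) (t s : R) : R := (h s - h t) / (s - t).

Definition derivable_on (T : R) (h : R -> R) (t : R) : Prop :=
  cvg (diff_quot h t s @[s --> within `[0, T] t^']).

Definition derive_on (T : R) (h : R -> R) (t : R) : R :=
  lim (diff_quot h t s @[s --> within `[0, T] t^']).

Definition C1_on (T : R) (h : R -> R) : Prop :=
  (forall (t : R), t \in `[0, T] -> derivable_on T h t) /\
  {within `[0, T], continuous (derive_on T h)}.

(* C^1 on [0, T] x Om (Om open): all first-order partial derivatives exist and
   are jointly continuous on [0, T] x Om. *)
Definition C1_on_prod (T : R) (n : nat) (Om : set 'rV[R]_n)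
    (h : R -> 'rV[R]_n -> R) : Prop :=
  [/\ forall (t : R) x, t \in `[0, T] -> Om x -> derivable_on T (h^~ x) t,
      {within `[0, T] `*` Om,
         continuous (fun z : R * 'rV[R]_n => derive_on T (h^~ z.2) z.1)},
      forall k (t : R) x, t \in `[0, T] -> Om x -> derivable (h t) x (delta_mx 0 k)
    & forall k, {within `[0, T] `*` Om,
         continuous (fun z : R * 'rV[R]_n => partial_mx (h z.1) k z.2)}].

End Calculus.

Section Equations.
Variables (R : realType) (N : nat) (edge : rel 'I_N).
Variable L : forall i : 'I_N, 'rV[R]_(deg edge i) -> R.

(* lim_{|lambda| -> +oo} l(lambda) / |lambda| = +oo on the orthant; the choice
   of norm is immaterial, and the condition is void when n = 0. *)
Definition superlinear (n : nat) (l : 'rV[R]_n -> R) : Prop :=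
  forall A : R, exists B : R, forall lam : 'rV[R]_n,
    orthant lam -> B < `|lam| -> A < l lam / `|lam|.

Definition hamiltonian (i : 'I_N) (p : 'rV[R]_(deg edge i)) : R :=
  sup [set dotv lam p - L lam | lam in @orthant R (deg edge i)].

Definition argmax_ham (i : 'I_N) (p : 'rV[R]_(deg edge i))
  : set 'rV[R]_(deg edge i) :=
  [set lam | orthant lam /\
     forall mu, orthant mu -> dotv mu p - L mu <= dotv lam p - L lam].

(* The direction is the basis vector of the coordinate indexed by [j] when
   [j \in succs edge i], the only case in which it is used (it is 0 otherwise). *)
Definition dham (i j : 'I_N) (p : 'rV[R]_(deg edge i)) : R :=
  'D_(\row_a (succ_node a == j)%:R) (@hamiltonian i) p.

(* (w_j - w_i), j ranging over [succs edge i] *)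
Definition gaps (w : 'I_N -> R) (i : 'I_N) : 'rV[R]_(deg edge i) :=
  \row_a (w (succ_node a) - w i).

Definition net_flow (w : 'I_N -> R) (x : 'rV[R]_N) (l : 'I_N) : R :=
  \sum_(j in preds edge l) dham (i := j) l (gaps w j) * x 0 j
  - \sum_(j in succs edge l) dham (i := l) j (gaps w l) * x 0 l.

Variables (T : R) (Om : set 'rV[R]_N) (f g : 'I_N -> 'rV[R]_N -> R).

Definition master_equations (U : 'I_N -> R -> 'rV[R]_N -> R) : Prop :=
  (forall i (t : R) x, t \in `[0, T] -> Om x ->
     derive_on T (fun s => U i s x) t
     + hamiltonian (gaps (fun k => U k t x) i)
     + \sum_(l < N) partial_mx (U i t) l x * net_flow (fun k => U k t x) x l
     + f i x = 0) /\
  (forall i x, Om x -> U i T x = g i x).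

Definition mfg_solution (m0 : 'rV[R]_N)
    (u : R -> 'I_N -> R) (m : R -> 'rV[R]_N) : Prop :=
  [/\ forall (t : R), t \in `[0, T] -> Om (m t),
      forall i (t : R), t \in `[0, T] ->
        derivable_on T (fun s => u s i) t /\
        derive_on T (fun s => u s i) t + hamiltonian (gaps (u t) i)
          + f i (m t) = 0,
      forall i, u T i = g i (m T),
      forall i (t : R), t \in `[0, T] ->
        derivable_on T (fun s => m s 0 i) t /\
        derive_on T (fun s => m s 0 i) t = net_flow (u t) (m t) i
    & m 0 = m0].

End Equations.

(* Main.v *)
Require Import Defs.
From HB Require Import structures.
From mathcomp Require Import all_boot all_order all_algebra.
From mathcomp Require Import all_classical all_reals all_analysis.
From mathcomp Require Import lra.
Import Order.TTheory GRing.Theory Num.Theory.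
Import numFieldNormedType.Exports.
Local Open Scope classical_set_scope.
Local Open Scope ring_scope.

(** The curve [m] is a characteristic of the master equation. Differentiating U_i(t, m(t)) by the
    chain rule gives the time derivative of U_i plus the sum over l of its m_l-derivative times
    m_l'(t). The equation for [m] turns m_l'(t) into [net_flow], so this is the transport term of
    the master equation at (t, m(t)), and what remains of that equation is the Hamilton-Jacobi half
    of the MFG system. The terminal condition is the master one at x = m(T). The analytic content is
    [chain_rule_on]. Derivatives in time are one-sided at 0 and T, and C^1 regularity of U is
    expressed by partial derivatives, so the rule is derived from two mean value theorems,
    [mean_value_on] in time and [mean_value_rV] in space, combined with joint continuity of the
    partial derivatives. *)

(** * Calculus on [[0, T]] with one-sided derivatives at the endpoints *)

Lemma cvg_to_within (X : Type) (Y : topologicalType) (F : set_system X)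
    (FF : Filter F) (A : set Y) (f : X -> Y) (y : Y) :
  f @ F --> y -> (\forall x \near F, A (f x)) -> f @ F --> within A (nbhs y).
Proof.
move=> fy fA P wP.
have : F ((fun x => A (f x) -> P (f x)) `&` (A \o f)).
  exact: filterI (fy _ wP) fA.
by apply: (@filterS _ F _ _ (P \o f)) => x [+ Ax]; apply.
Qed.

(** Properness gives uniqueness of limits, hence lets [cvg_derivable_on] read off the value of
    [derive_on] from any limit of the quotients. *)
Lemma within_dnbhs_proper (R : realType) (T t : R) :
  0 < T -> t \in `[0, T] -> ProperFilter (within `[0, T] t^').
Proof.
move=> T0; rewrite in_itv /= => /andP[t0 tT].
apply: Build_ProperFilter_ex => P; rewrite /within /dnbhs /= /within /=.
move=> /nbhs_ballP[e /= e0 Pe].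
(* The bound [T / 2] keeps a step of length [d] from [t] towards the farther endpoint inside
   [0, T]. *)
set d := Num.min (e / 2) (T / 2).
have d0 : 0 < d by rewrite lt_min; apply/andP; split; lra.
have de : d < e by rewrite gt_min; apply/orP; left; lra.
have dT : d <= T / 2 by rewrite ge_min lexx orbT.
have [tT2|tT2] := leP t (T / 2).
  exists (t + d); apply: Pe.
  - by rewrite /ball /= opprD addNKr normrN gtr0_norm.
  - by apply/eqP; lra.
  - by rewrite in_itv /=; apply/andP; split; lra.
exists (t - d); apply: Pe.
- by rewrite /ball /= opprB addrC subrK gtr0_norm.
- by apply/eqP; lra.
- by rewrite in_itv /=; apply/andP; split; lra.
Qed.

Lemma derivable_on_cvg (R : realType) (T t : R) (h : R -> R) :
  derivable_on T h t ->
  diff_quot h t s @[s --> within `[0, T] t^'] --> derive_on T h t.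
Proof. by []. Qed.

Lemma cvg_derivable_on (R : realType) (T t l : R) (h : R -> R) :
    0 < T -> t \in `[0, T] ->
    diff_quot h t s @[s --> within `[0, T] t^'] --> l ->
  derivable_on T h t /\ derive_on T h t = l.
Proof.
move=> T0 tT hl; split; first by apply/cvg_ex; exists l.
have FF := @within_dnbhs_proper R T t T0 tT.
exact/cvg_lim.
Qed.

Lemma cvg_within_dnbhs_id (R : realType) (T t : R) :
  s @[s --> within `[0, T] t^'] --> t.
Proof.
move=> P; rewrite /within /= /dnbhs /within /= => Pt.
by rewrite /nbhs /=; apply: filterS Pt.
Qed.

Lemma near_within_dnbhsE (R : realType) (T t : R) (P : set R) :
  (\forall s \near within `[0, T] t^', P s) =
  (\forall s \near t, s != t -> s \in `[0, T] -> P s).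
Proof. by []. Qed.

Lemma near_within_dnbhs (R : realType) (T t : R) :
  \forall s \near within `[0, T] t^', s \in `[0, T] /\ s != t.
Proof.
by rewrite near_within_dnbhsE; near=> s.
Unshelve. all: by end_near. Qed.

Lemma derivable_on_cvg_value (R : realType) (T t : R) (h : R -> R) :
  derivable_on T h t -> h s @[s --> within `[0, T] t^'] --> h t.
Proof.
move=> /derivable_on_cvg dh.
have FF : Filter (within `[0, T] t^') by exact: within_filter.
have : h t + diff_quot h t s * (s - t) @[s --> within `[0, T] t^']
    --> h t + derive_on T h t * (t - t).
  apply: cvgD; first exact: cvg_cst.
  apply: cvgM => //; apply: cvgB; [exact: cvg_within_dnbhs_id|exact: cvg_cst].
rewrite subrr mulr0 addr0; apply: cvg_trans; apply: near_eq_cvg.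
have := near_within_dnbhs R T t; apply: filterS => s [_ st].
by rewrite /diff_quot divfK ?subr_eq0// addrC subrK.
Qed.

Lemma derivable_on_continuous (R : realType) (T : R) (h : R -> R) :
  (forall t, t \in `[0, T] -> derivable_on T h t) ->
  {within `[0, T], continuous h}.
Proof.
move=> dh; apply/subspace_continuousP => t tT.
have FF : Filter (within `[0, T] (nbhs t)) by exact: within_filter.
have FF' : Filter (within `[0, T] t^') by exact: within_filter.
have /cvgrPdist_lt ht := @derivable_on_cvg_value R T t h (dh t tT).
apply/cvgrPdist_lt => e e0; rewrite near_withinE.
move: (ht e e0); rewrite near_within_dnbhsE; apply: filterS => s hs sT.
(* The limit [ht] is over the punctured filter, so [s = t] is treated apart. *)
have [->|st] := eqVneq s t; first by rewrite subrr normr0.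
exact: hs.
Qed.

(** Near an interior point the constraint that [s] lie in [0, T] always holds, so both notions of
    derivative take the same limit. This gives access to [MVT_segment]. *)
Lemma derivable_on_is_derive (R : realType) (T t : R) (h : R -> R) :
  t \in `]0, T[ -> derivable_on T h t -> is_derive t 1 h (derive_on T h t).
Proof.
move=> tT /derivable_on_cvg dh.
suff dht : (fun e => e^-1 *: ((h \o shift t) (e *: 1) - h t)) @ 0^'
    --> derive_on T h t.
  apply: DeriveDef; first by apply/cvg_ex; exists (derive_on T h t).
  exact: cvg_lim.
have FF : Filter (within `[0, T] t^') by exact: within_filter.
apply/cvgrPdist_lt => e e0.
have /cvgrPdist_lt/(_ e e0) := dh.
have nT : \forall s \near t, s \in `[0, T].
  by have := near_in_itvoo tT; apply: filterS => s; exact: subset_itv_oo_cc.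
rewrite near_within_dnbhsE => /nbhs0P ht; rewrite /dnbhs near_withinE.
move/nbhs0P: nT; move: ht; apply: filterS2 => r /= hr rT r0.
have rt : t + r != t by rewrite -subr_eq0 (addrC t) addrK.
move: (hr rt rT); rewrite /diff_quot (addrC t r) addrK /= scaler1.
by rewrite [_ *: _]mulrC.
Qed.

(** The classical theorem asks for two-sided derivatives only in the interior and continuity up to
    the endpoints, which one-sided derivability supplies. The bound on [c] is stated by distance to
    [a] so that it serves for both orders of [a] and [b] and forces [c] to [a] as [b] tends to
    [a]. *)
Lemma mean_value_on (R : realType) (T a b : R) (h : R -> R) :
    (forall t, t \in `[0, T] -> derivable_on T h t) ->
    a \in `[0, T] -> b \in `[0, T] ->
  exists c, [/\ c \in `[0, T], `|c - a| <= `|b - a|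
    & h b - h a = derive_on T h c * (b - a)].
Proof.
move=> dh.
have mvt x y : x \in `[0, T] -> y \in `[0, T] -> x <= y ->
    exists2 c, c \in `[x, y] & h y - h x = derive_on T h c * (y - x).
  rewrite !in_itv /= => /andP[x0 xT] /andP[y0 yT] xy.
  apply: MVT_segment => // [c|].
    rewrite in_itv /= => /andP[xc cy].
    apply: derivable_on_is_derive; rewrite ?in_itv /=; first by apply/andP; split; lra.
    by apply: dh; rewrite in_itv /=; apply/andP; split; lra.
  apply: continuous_subspaceW (@derivable_on_continuous R T h dh) => c /=.
  by rewrite !in_itv /= => /andP[xc cy]; apply/andP; split; lra.
move=> aT bT; have [ab|/ltW ba] := leP a b.
  have [c cab hab] := mvt a b aT bT ab; exists c; move: cab aT bT.
  rewrite !in_itv /= => /andP[ac cb] /andP[a0 aT] /andP[b0 bT]; split=> //.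
    by apply/andP; split; lra.
  by rewrite !ger0_norm; lra.
have [c cab hab] := mvt b a bT aT ba; exists c; move: cab aT bT.
rewrite !in_itv /= => /andP[ac cb] /andP[a0 aT] /andP[b0 bT]; split=> //.
  by apply/andP; split; lra.
  by rewrite !ler0_norm; lra.
by rewrite -opprB hab -mulrN opprB.
Qed.

(** * Mean value theorems in space *)

Lemma derivable_line (R : realType) (V : normedModType R) (h : V -> R)
    (x d : V) (r : R) :
  derivable h (x + r *: d) d ->
  is_derive r 1 (fun s => h (x + s *: d)) ('D_d h (x + r *: d)).
Proof.
move=> dh.
have E : (fun e : R => e^-1 *: (((fun s => h (x + s *: d)) \o shift r) (e *: 1)
      - h (x + r *: d)))
    = (fun e => e^-1 *: ((h \o shift (x + r *: d)) (e *: d) - h (x + r *: d))).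
  apply/funext => e /=; congr (_ *: (h _ - _)).
  by rewrite scaler1 scalerDl addrCA.
by apply: DeriveDef; rewrite /derivable /derive E.
Qed.

Lemma mean_value_line (R : realType) (V : normedModType R) (h : V -> R)
    (x d : V) (a : R) :
    (forall r, `|r| <= `|a| -> derivable h (x + r *: d) d) ->
  exists2 r, `|r| <= `|a| & h (x + a *: d) - h x = a * 'D_d h (x + r *: d).
Proof.
move=> dh; pose g (s : R) := h (x + s *: d).
have mvt u v : u <= v -> `|u| <= `|a| -> `|v| <= `|a| ->
    exists2 r, `|r| <= `|a| & g v - g u = 'D_d h (x + r *: d) * (v - u).
  move=> uv ua va.
  have rP r : r \in `[u, v] -> `|r| <= `|a|.
    by rewrite in_itv /=; move: ua va; rewrite !ler_norml => *; lra.
  have [|||r /rP ra] := @MVT_segment R g (fun r => 'D_d h (x + r *: d)) u v => //.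
  - move=> r ruv; apply/derivable_line/dh/rP.
    exact: subset_itv_oo_cc.
  - apply: derivable_within_continuous => r /rP /dh /derivable_line.
    by move=> rd; exact: ex_derive.
  - by exists r.
have g0 : g 0 = h x by rewrite /g scale0r addr0.
have n0 : `|0 : R| <= `|a| by rewrite normr0.
have [a0|/ltW a0] := leP 0 a.
  have [r ra] := mvt 0 a a0 n0 (lexx _); rewrite g0 subr0 mulrC.
  by exists r.
have [r ra] := mvt a 0 a0 (lexx _) n0; rewrite g0 sub0r mulrN mulrC => E.
by exists r => //; rewrite -[LHS]opprB E opprK.
Qed.

Lemma ler_mx_norm_row (R : realType) (n : nat) (v : 'rV[R]_n) (e : R) :
  0 <= e -> (`|v| <= e) <-> (forall k, `|v 0 k| <= e).
Proof.
move=> e0; rewrite {1}/Num.norm /= mx_normrE; split => [/bigmax_leP[_ H] k|H].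
  exact: (H (0, k)).
by apply/bigmax_leP; split => // -[i k] _ /=; rewrite (ord1 i).
Qed.

(** Walk from [x] to [x + v] changing one coordinate at a time, apply the one-dimensional theorem on
    each edge and telescope. Each edge has its own intermediate point; in the sup norm the whole
    path stays within [|v|] of [x]. *)
Lemma mean_value_rV (R : realType) (n : nat) (h : 'rV[R]_n -> R)
    (x v : 'rV[R]_n) :
    (forall y k, `|y - x| <= `|v| -> derivable h y (delta_mx 0 k)) ->
  exists xi : 'I_n -> 'rV[R]_n, (forall k, `|xi k - x| <= `|v|) /\
    h (x + v) - h x = \sum_(k < n) v 0 k * partial_mx h k (xi k).
Proof.
move=> dh.
have vk k : `|v 0 k| <= `|v| by move: k; apply/ler_mx_norm_row.
(* Corner [y k] has the first [k] coordinates already moved. *)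
pose y (k : nat) : 'rV[R]_n := x + \row_j (if (j < k)%N then v 0 j else 0).
have yS (k : 'I_n) : y k.+1 = y k + v 0 k *: delta_mx 0 k.
  apply/rowP => j; rewrite !mxE eqxx /= ltnS leq_eqVlt -addrA; congr (_ + _).
  case: (eqVneq j k) => [->|jk]; first by rewrite eqxx ltnn /= mulr1 add0r.
  by rewrite (inj_eq val_inj) (negbTE jk) /= mulr0 addr0.
have close (k : 'I_n) r : `|r| <= `|v 0 k| ->
    `|y k + r *: delta_mx 0 k - x| <= `|v|.
  move=> rv; apply/ler_mx_norm_row => // j.
  rewrite !mxE eqxx /= -[x 0 j + _ + _]addrA [x 0 j + _]addrC addrK.
  case: (eqVneq j k) => [->|jk].
    by rewrite ltnn /= mulr1 add0r; exact: le_trans (vk k).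
  by rewrite mulr0 addr0; case: ifP => // _; rewrite normr0.
have mvt (k : 'I_n) : exists xi, `|xi - x| <= `|v| /\
    h (y k.+1) - h (y k) = v 0 k * partial_mx h k xi.
  have [|r ra E] := @mean_value_line R _ h (y k) (delta_mx 0 k) (v 0 k).
    by move=> r rv; apply/dh/close.
  by exists (y k + r *: delta_mx 0 k); rewrite yS; split => //; exact: close.
have [xi xiP] := choice mvt; exists xi; split => [k|]; first by have [] := xiP k.
have -> : x + v = y n by congr (_ + _); apply/rowP => j; rewrite mxE ltn_ord.
have -> : h x = h (y 0%N).
  by rewrite -[x in LHS]addr0; congr (h (_ + _)); apply/rowP => j; rewrite !mxE.
rewrite -(@telescope_sumr _ 0 n (h \o y))// big_mkord.
by apply: eq_bigr => k _; have [] := xiP k.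
Qed.

(** * Chain rule along a curve *)

Lemma cvg_dominated (R : realType) (V W : normedModType R) (X : Type)
    (F : set_system X) (FF : Filter F) (a : X -> V) (b : X -> W) (x : V) (y : W) :
    b @ F --> y -> (\forall s \near F, `|a s - x| <= `|b s - y|) ->
  a @ F --> x.
Proof.
move=> by_ ab; apply/cvgrPdist_lt => e e0.
have /cvgrPdist_lt/(_ e e0) := by_; move: ab; apply: filterS2 => s.
by rewrite distrC [`|y - _|]distrC; exact: le_lt_trans.
Qed.

Lemma cvg_rV (R : realType) (n : nat) (X : Type) (F : set_system X)
    (FF : Filter F) (m : X -> 'rV[R]_n) (y : 'rV[R]_n) :
  (forall k, m s 0 k @[s --> F] --> y 0 k) -> m @ F --> y.
Proof.
move=> my; apply/cvgrPdist_le => e e0.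
have : \forall s \near F, forall k, `|y 0 k - m s 0 k| <= e.
  by apply: filter_forall => k; have /cvgrPdist_le/(_ e e0) := my k.
apply: filterS => s ms; apply/ler_mx_norm_row; first exact: ltW.
by move=> k; rewrite !mxE.
Qed.

(* The increment of [U s (m s)] is split at [U t (m s)]: the mean value theorem
   expresses both parts by partial derivatives at intermediate points, which
   tend to [(t, m t)], where these derivatives are jointly continuous. *)
Lemma chain_rule_on (R : realType) (T t : R) (n : nat) (Om : set 'rV[R]_n)
    (U : R -> 'rV[R]_n -> R) (m : R -> 'rV[R]_n) :
    open Om -> C1_on_prod T Om U -> t \in `[0, T] ->
    (forall s, s \in `[0, T] -> Om (m s)) ->
    (forall k, derivable_on T (fun s => m s 0 k) t) ->
  diff_quot (fun s => U s (m s)) t s @[s --> within `[0, T] t^'] -->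
  derive_on T (U^~ (m t)) t
  + \sum_(k < n) partial_mx (U t) k (m t) * derive_on T (fun s => m s 0 k) t.
Proof.
move=> Om_open [dUt cUt dUx cUx] tT m_Om dm.
pose F := within `[0, T] t^'.
have FF : Filter F by exact: within_filter.
have mF : m @ F --> m t.
  by apply: cvg_rV => k; apply: derivable_on_cvg_value; exact: dm.
have idF : s @[s --> F] --> t by exact: cvg_within_dnbhs_id.
(* The coordinate path from [m t] to [m s] has to stay in [Om]; it does once [m s] enters this
   ball. *)
have [e /= e0 eOm] : exists2 e : R, 0 < e & ball (m t) e `<=` Om.
  have /nbhs_ballP[e /= e0 eOm] : nbhs (m t) Om.
    by apply: open_nbhs_nbhs; split=> //; exact: m_Om.
  by exists e.
have ballOm x : `|x - m t| < e -> Om x.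
  by move=> xe; apply: eOm; rewrite -ball_normE /= distrC.
have nearT : \forall s \near F, s \in `[0, T] /\ s != t.
  exact: near_within_dnbhs.
have neare : \forall s \near F, `|m s - m t| < e.
  have /cvgrPdist_lt/(_ e e0) := mF.
  by apply: filterS => s; rewrite distrC.
(* Intermediate times with the space variable frozen at [m s]; outside [0, T] the value 0 is a dummy
   that makes [choice] applicable. *)
have /choice[th thP] : forall s, exists c, s \in `[0, T] ->
    [/\ c \in `[0, T], `|c - t| <= `|s - t| &
      U s (m s) - U t (m s) = derive_on T (U^~ (m s)) c * (s - t)].
  move=> s; have [sT|] := boolP (s \in `[0, T]); last by exists 0.
  have [c ?] := mean_value_on _ _ _ _ _ (fun r rT => dUt r _ rT (m_Om _ sT)) tT sT.
  by exists c.
have /choice[xi xiP] : forall s, exists xi : 'I_n -> 'rV[R]_n,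
    `|m s - m t| < e -> (forall k, `|xi k - m t| <= `|m s - m t|) /\
    U t (m s) - U t (m t)
      = \sum_(k < n) (m s - m t) 0 k * partial_mx (U t) k (xi k).
  move=> s; have [se|] := boolP (`|m s - m t| < e); last by exists (fun=> 0).
  have [|xi [xi1 xi2]] := @mean_value_rV R n (U t) (m t) (m s - m t).
    by move=> y k ye; apply: dUx => //; apply/ballOm/(le_lt_trans ye).
  by exists xi => _; split => //; rewrite -xi2 (addrC (m t)) subrK.
(* Intermediate times and points are squeezed: they are no farther from [t] and [m t] than [s] and
   [m s] are. *)
have thF : th @ F --> t.
  apply: (cvg_dominated _ _ _ _ _ _ _ _ _ _ idF); apply: filterS nearT => s [sT _].
  by have [] := thP s sT.
have xiF k : xi s k @[s --> F] --> m t.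
  apply: (cvg_dominated _ _ _ _ _ _ _ _ _ _ mF); apply: filterS neare => s se.
  by have [] := xiP s se.
(* Joint continuity is essential here, since time and space arguments both move with [s]. *)
have cvgt : derive_on T (U^~ (m s)) (th s) @[s --> F] -->
    derive_on T (U^~ (m t)) t.
  have /subspace_continuousP/(_ (t, m t)) := cUt.
  move=> /(_ (conj tT (m_Om _ tT))) /= /(cvg_comp (fun s => (th s, m s))); apply.
  apply: cvg_to_within; first exact: (cvg_pair thF mF).
  apply: filterS nearT => s [sT _]; split => /=; last exact: m_Om.
  by have [] := thP s sT.
have cvgx k : partial_mx (U t) k (xi s k) @[s --> F] -->
    partial_mx (U t) k (m t).
  have /subspace_continuousP/(_ (t, m t)) := cUx k.
  move=> /(_ (conj tT (m_Om _ tT))) /= /(cvg_comp (fun s => (t, xi s k))); apply.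
  apply: cvg_to_within; first exact: (cvg_pair (cvg_cst t) (xiF k)).
  apply: filterS neare => s se; split => //=; apply: ballOm.
  by have [+ _] := xiP s se => /(_ k) /le_lt_trans; apply.
have : derive_on T (U^~ (m s)) (th s) + \sum_(k < n)
      partial_mx (U t) k (xi s k) * diff_quot (fun s => m s 0 k) t s @[s --> F]
    --> derive_on T (U^~ (m t)) t + \sum_(k < n)
      partial_mx (U t) k (m t) * derive_on T (fun s => m s 0 k) t.
  apply: cvgD => //; apply: cvg_big => [|k _]; first exact: add_continuous.
   apply: cvgM => //; exact: dm.
apply: cvg_trans; apply: near_eq_cvg.
move: nearT neare; apply: filterS2 => s [sT st] se.
have [_ _ Et] := thP s sT; have [_ Ex] := xiP s se.
have st0 : s - t != 0 by rewrite subr_eq0.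
rewrite /diff_quot -[U s (m s) - _](subrKA (U t (m s))) Et Ex mulrDl mulfK//.
rewrite mulr_suml; congr (_ + _); apply: eq_bigr => k _.
by rewrite !mxE mulrA [partial_mx _ _ _ * _]mulrC.
Qed.

Theorem proposition4 (R : realType) (N : nat) (edge : rel 'I_N)
  (edge_irr : irreflexive edge)
  (L : forall i : 'I_N, 'rV[R]_(deg edge i) -> R)
  (L_cont : forall i, {within @orthant R (deg edge i), continuous (L i)})
  (L_superlinear : forall i, superlinear (L i))
  (H_C1 : forall i, C1 (@hamiltonian R N edge L i))
  (H_argmax : forall i (p : 'rV[R]_(deg edge i)),
     argmax_ham L p = [set gradient (@hamiltonian R N edge L i) p])
  (T : R) (T_gt0 : 0 < T)
  (Om : set 'rV[R]_N) (Om_open : open Om) (Om_connected : connected Om)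
  (Om_simplex : @simplex R N `<=` Om)
  (f g : 'I_N -> 'rV[R]_N -> R)
  (f_cont : forall i, {within Om, continuous (f i)})
  (g_cont : forall i, {within Om, continuous (g i)})
  (U : 'I_N -> R -> 'rV[R]_N -> R)
  (U_C1 : forall i, C1_on_prod T Om (U i))
  (U_master : master_equations L T Om f g U)
  (m0 : 'rV[R]_N) (m0_simplex : simplex m0)
  (m : R -> 'rV[R]_N)
  (m_Om : forall (t : R), t \in `[0, T] -> Om (m t))
  (m_C1 : forall i, C1_on T (fun s => m s 0 i))
  (m_ode : forall i (t : R), t \in `[0, T] ->
     derive_on T (fun s => m s 0 i) t
     = net_flow L (fun k => U k t (m t)) (m t) i)
  (m_init : m 0 = m0) :
  mfg_solution L T Om f g m0 (fun t i => U i t (m t)) m.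
Proof.
have [U_pde U_T] := U_master.
have T_in : T \in `[0, T] by rewrite in_itv /= lexx ltW.
split=> //.
- move=> i t tT.
  have dm k : derivable_on T (fun s => m s 0 k) t.
    by have [+ _] := m_C1 k; apply.
  have dUm := chain_rule_on _ _ _ _ _ _ _ Om_open (U_C1 i) tT m_Om dm.
  (* The chain rule limit yields both derivability of [u] and the value of its derivative. *)
  have [dU ->] := cvg_derivable_on _ _ _ _ _ T_gt0 tT dUm.
  split => //; rewrite -[RHS](U_pde i t (m t) tT (m_Om t tT)).
  under eq_bigr do rewrite m_ode//.
  by rewrite [X in X + _]addrAC.
- by move=> i; apply/U_T/m_Om.
- by move=> i t tT; split; [have [+ _] := m_C1 i; apply|exact: m_ode].
Qed.
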